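(* Let $T\ge 1$ be an integer and let $h:\mathbb{R}\to\mathbb{R}$ be convex and $1$-Lipschitz. Against every adversary (the loss gradients $g_1,\dots,g_T\in\mathbb{R}$ may be arbitrary and need not be bounded a priori), the Stein algorithm with input $h$ and any admissible choice of parameters $\rho_0,\dots,\rho_T$ guarantees $$\sum_{t=1}^T g_tx_t\le -\mathbb{E}_{Z}\Big[h\Big(\sum_{t=1}^Tg_t+\rho_T Z\Big)\Big]+\mathbb{E}_{Z}[h(\rho_0Z)]+\sum_{t=1}^T\left(\sqrt{\frac{2}{\pi}}\,\frac{\max\{g_t^2-c_t,0\}}{\rho_{t-1}}+\frac{2c_t|g_t|+|g_t|^3}{\rho_{t-1}^2}\right),$$ where $Z\sim\mathcal{N}(0,1)$.
   Context: Online linear optimization (OLO) game with horizon $T$: in each round $t=1,\dots,T$, the algorithm picks $x_t\in[-1,1]$ as a function of $g_1,\dots,g_{t-1}$ (and $T$); the adversary then picks $g_t\in\mathbb{R}$ as a function of $x_1,\dots,x_t$ (and $T$ and the algorithm); the algorithm observes $g_t$ and suffers loss $g_tx_t$. Stein equation solution: for a $1$-Lipschitz $h:\mathbb{R}\to\mathbb{R}$, $\mu\in\mathbb{R}$, $\sigma>0$, let $f_{\mu,\sigma,h}:\mathbb{R}\to\mathbb{R}$ be the unique bounded solution of $\sigma^2f'(x)-(x-\mu)f(x)=h(x)-\mathbb{E}_{Z\sim\mathcal{N}(0,1)}[h(\mu+\sigma Z)]$ for all $x\in\mathbb{R}$. Stein algorithm with input $h$: set $s_0=0$ and choose an arbitrary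 $\rho_0>0$. In round $t$, choose (possibly depending on $g_1,\dots,g_{t-1}$) an arbitrary $\rho_t\in[0,\rho_{t-1}]$, with $\rho_t>0$ required if $t<T$ (such choices are called admissible); let $c_t=\rho_{t-1}^2-\rho_t^2\ge0$; output $x_t=\mathbb{E}_{Z\sim\mathcal{N}(0,1)}[f_{s_{t-1},\rho_{t-1},h}(s_{t-1}+\rho_tZ)]$; observe $g_t$ and set $s_t=s_{t-1}+g_t$. *)

(* Defs.v *)
From mathcomp Require Export all_boot all_order all_algebra.
From mathcomp Require Export all_classical all_reals all_analysis.
Export Order.TTheory GRing.Theory Num.Theory.
Export numFieldNormedType.Exports.

Set Implicit Arguments.
Unset Strict Implicit.
Unset Printing Implicit Defensive.

Local Open Scope classical_set_scope.
Local Open Scope ring_scope.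

(* E[phi(Z)] for Z ~ N(0,1).  [fine] sends an infinite integral to 0; it is
   harmless when phi is integrable, e.g. Lipschitz, or bounded and measurable. *)
Definition gaussE {R : realType} (phi : R -> R) : R :=
  fine ('E_(normal_prob 0 1)[phi])%E.

Definition stein_solution {R : realType} (mu sigma : R) (h f : R -> R) : Prop :=
  [/\ [bounded f x | x in [set: R]],
      forall x, derivable f x 1 &
      forall x, sigma ^+ 2 * f^`()%classic x - (x - mu) * f x
                = h x - gaussE (fun z => h (mu + sigma * z))].

(* Classical choice of a bounded solution, which is unique when h is
   1-Lipschitz and 0 < sigma. *)
Definition stein_fun {R : realType} (mu sigma : R) (h : R -> R) : R -> R :=
  get [set f | stein_solution mu sigma h f].

(* The algorithm maps g_1, ..., g_{t-1} to x_t; the adversary maps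
   x_1, ..., x_t to g_t. *)
Definition algorithm (R : Type) := seq R -> R.
Definition adversary (R : Type) := seq R -> R.

Fixpoint play {R : Type} (alg : algorithm R) (adv : adversary R) (t : nat) :
    seq R * seq R :=
  if t is t'.+1 then
    let: (xs, gs) := play alg adv t' in
    let xs' := rcons xs (alg gs) in
    (xs', rcons gs (adv xs'))
  else ([::], [::]).

Definition gradients {R : Type} (alg : algorithm R) (adv : adversary R)
    (t : nat) : seq R := (play alg adv t).2.

(* x_t and g_t, for rounds t >= 1 *)
Definition decision {R : realType} (alg : algorithm R) (adv : adversary R)
    (t : nat) : R := nth 0 (play alg adv t).1 t.-1.
Definition gradient {R : realType} (alg : algorithm R) (adv : adversary R)
    (t : nat) : R := nth 0 (play alg adv t).2 t.-1.

(* A parameter policy gives rho_t as a function of g_1, ..., g_{t-1}; rho_0 is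
   read off the empty history. *)
Definition policy (R : Type) := nat -> seq R -> R.

Definition param {R : Type} (rho : policy R) (gs : seq R) (t : nat) : R :=
  rho t (take t.-1 gs).

(* [t <= (size gs).+1] says that gs contains g_1, ..., g_{t-1}. *)
Definition admissible {R : realType} (T : nat) (rho : policy R) : Prop :=
  0 < param rho [::] 0%N /\
  forall (gs : seq R) (t : nat), (1 <= t <= T)%N -> (t <= (size gs).+1)%N ->
    0 <= param rho gs t <= param rho gs t.-1 /\
    ((t < T)%N -> 0 < param rho gs t).

Definition stein_algorithm {R : realType} (h : R -> R) (rho : policy R) :
    algorithm R :=
  fun gs =>
    let t := (size gs).+1 in
    let s := \sum_(g <- gs) g in
    gaussE (fun z => stein_fun s (param rho gs t.-1) h (s + param rho gs t * z)).

(* Main.v *)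
(** Write f for the Stein solution used in round t, sigma = rho_(t-1),
    rho = rho_t, c = sigma^2 - rho^2 and y = s_(t-1) + rho Z.  The Stein
    equation at y + g_t, together with the Gaussian integration by parts
    E[Z phi(Z)] = E[phi'(Z)], gives
      E h(y + g_t) - E h(s_(t-1) + sigma Z) + g_t x_t
        = E[c f'(y + g_t) - g_t (f(y + g_t) - f(y))],
    and the right-hand side is bounded pointwise by the error term as soon as
    -sqrt(2/pi)/sigma <= f' <= 0 and f' is 2/sigma^2-Lipschitz; the sum over
    the rounds telescopes.

    After rescaling to f' - x f = k, the three bounds on f' all come from one
    comparison principle: with w = exp(-x^2/2) one has (w f)' = w k and w f
    vanishes at both ends, so f can be compared with explicit sub- and
    supersolutions on half lines.  The sign of f' comes from a supporting line
    of k.  The constant sqrt(2/pi), attained by k(t) = |t - x|, reduces to the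
    inequality (w(x) + x N(x))^2 <= pi/2 x^2 + w(x) with N(x) the integral of
    w over [0, x]. *)

Require Import Defs.
From mathcomp Require Import measurable_realfun ring lra.

Set Implicit Arguments.
Unset Strict Implicit.
Unset Printing Implicit Defensive.

Local Open Scope classical_set_scope.
Local Open Scope ring_scope.

(** * Expectations under the standard normal law as Lebesgue integrals *)

(** The Radon-Nikodym derivative of the normal law agrees almost everywhere with [normal_pdf],
    because both have the same integral over every measurable set. *)
Lemma ge0_integral_normal_prob (R : realType) (f : R -> \bar R) :
  measurable_fun setT f -> (forall x, 0 <= f x)%E ->
  (\int[normal_prob 0 1]_x f x = \int[lebesgue_measure]_x (f x * (normal_pdf 0 1 x)%:E))%E.
Proof.
move=> mf f0.
have Pmu := @normal_prob_dominates R 0 1.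
rewrite -(Radon_Nikodym_SigmaFinite.change_of_variables Pmu)//.
have RNi := Radon_Nikodym_SigmaFinite.f_integrable Pmu.
apply: ae_eq_integral => //.
- by apply: emeasurable_funM => //; exact: (measurable_int (@lebesgue_measure R)).
- apply: emeasurable_funM => //; apply/measurableT_comp => //.
  exact: measurable_normal_pdf.
- apply: ae_eqe_mul2l => /=.
  apply: integral_ae_eq => //=.
  + by apply/measurableT_comp => //; exact: measurable_normal_pdf.
  + by move=> E _ mE; rewrite -Radon_Nikodym_SigmaFinite.f_integral.
Qed.

Lemma integral_normal_prob (R : realType) (f : R -> R) :
  measurable_fun setT f ->
  (\int[normal_prob 0 1]_x (f x)%:E = \int[lebesgue_measure]_x (f x * normal_pdf 0 1 x)%:E)%E.
Proof.
move=> mf.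
have pdf0 x : 0 <= normal_pdf 0 1 x :> R by rewrite normal_pdf_ge0.
rewrite [LHS]integralE [RHS]integralE; congr (_ - _)%E.
- rewrite ge0_integral_normal_prob//; last first.
    by apply: measurable_funepos; exact/measurable_EFinP.
  apply: eq_integral => x _; rewrite !funeposE /= EFinM.
  by rewrite maxe_pMl ?lee_fin // mul0e.
- rewrite ge0_integral_normal_prob//; last first.
    by apply: measurable_funeneg; exact/measurable_EFinP.
  apply: eq_integral => x _; rewrite !funenegE /= -mulNr EFinM.
  by rewrite maxe_pMl ?lee_fin // mul0e.
Qed.

(** * Primitives of integrable functions on the whole line *)

(** Serves with [D] empty when [u] tends to -oo and with [D] the whole line when [u] tends to +oo,
    so that one dominated convergence gives both limits of a primitive. *)
Lemma cvg_integral_itvNy (R : realType) (f : R -> R) (u : R^nat) (D : set R) :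
  measurable D ->
  lebesgue_measure.-integrable setT (EFin \o f) ->
  (forall x, (\forall n \near \oo, (x <= u n) = (x \in D))) ->
  (\int[lebesgue_measure]_(t in `]-oo, u n]) f t) @[n --> \oo] -->
    \int[lebesgue_measure]_(t in D) f t.
Proof.
move=> mD fi uD.
have mf := measurable_int _ fi.
have fiD := @integrableS _ _ _ lebesgue_measure _ _ _ measurableT mD (@subsetT _ D) fi.
apply: fine_cvg; rewrite fineK; last exact: integrable_fin_num.
rewrite integral_mkcond.
under eq_cvg do rewrite integral_mkcond.
have [] := @dominated_convergence _ _ _ lebesgue_measure setT measurableT
  (fun n => (EFin \o f) \_ `]-oo, u n]) ((EFin \o f) \_ D)
  (abse \o (EFin \o f)) => //.
- by move=> n; apply/(measurable_restrictT _ _).1 => //; exact: measurable_funTS.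
- by apply/(measurable_restrictT _ _).1 => //; exact: measurable_funTS.
- apply: aeW => x _.
  apply: cvg_near_cst; have := uD x; apply: filterS => n ux.
  by rewrite !patchE -ux mem_setE in_itv.
- exact: integrable_abse.
- apply: aeW => x n _ /=. rewrite patchE; case: ifP => _ /=. by []. by rewrite normr0 lee_fin.
Qed.
Lemma improper_primitive (R : realType) (f : R -> R) :
  continuous f -> lebesgue_measure.-integrable setT (EFin \o f) ->
  exists F : R -> R, [/\ forall x : R, is_derive x 1 F (f x),
    F x @[x --> -oo] --> 0 &
    F x @[x --> +oo] --> \int[lebesgue_measure]_x f x].
Proof.
move=> cf fi.
pose F x := \int[lebesgue_measure]_(t in `]-oo, x]) f t.
have uI (u : R) : lebesgue_measure.-integrable `]-oo, u] (EFin \o f).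
  by apply: integrableS fi => //.
exists F; split.
- move=> x.
  have xx1 : x < x + 1 by rewrite ltrDl.
  have ax : (-oo < x%:E)%E by rewrite ltNyr.
  have [dF F1] := continuous_FTC1 xx1 (uI _) ax (cf x).
  by split; rewrite -?derive1E.
- apply/(cvg_ninftyP _ _).2 => u uoo.
  rewrite -(Rintegral_set0 lebesgue_measure f).
  apply: cvg_integral_itvNy => // x.
  have /cvgrNyPlt/(_ x) := uoo; apply: filterS => n un.
  by rewrite in_set0 leNgt un.
- apply/cvg_pinftyP => u uoo.
  apply: cvg_integral_itvNy => // x.
  have /cvgryPge/(_ x) := uoo; apply: filterS => n un.
  by rewrite in_setT un.
Qed.

(** * The Gaussian weight and expectations of functions of linear growth *)

Definition gauss_weight (R : realType) (x : R) : R := expR (- (x ^+ 2 / 2)).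

Lemma gauss_weight_gt0 (R : realType) (x : R) : 0 < gauss_weight x.
Proof. exact: expR_gt0. Qed.

Lemma gauss_weightN (R : realType) (x : R) : gauss_weight (- x) = gauss_weight x.
Proof. by rewrite /gauss_weight sqrrN. Qed.

Global Instance is_derive_gauss_weight (R : realType) (x : R) :
  is_derive x 1 (@gauss_weight R) (- x * gauss_weight x).
Proof.
rewrite /gauss_weight.
apply: is_derive_eq.
rewrite /GRing.scale /=. by field.
Qed.

Lemma is_derive_continuous (R : realType) (f f' : R -> R) :
  (forall x : R, is_derive x 1 f (f' x)) -> continuous f.
Proof.
move=> df x; apply/differentiable_continuous/derivable1_diffP.
exact: (@ex_derive _ _ _ _ _ _ _ (df x)).
Qed.

Lemma continuous_gauss_weight (R : realType) : continuous (@gauss_weight R).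
Proof. exact: is_derive_continuous (@is_derive_gauss_weight R). Qed.

Lemma normal_pdf_gauss_weight (R : realType) (x : R) :
  normal_pdf 0 1 x = (Num.sqrt (pi *+ 2))^-1 * gauss_weight x.
Proof.
rewrite normal_pdfE ?oner_eq0 // /normal_peak /normal_fun /gauss_weight.
by rewrite expr1n mul1r subr0 mulNr.
Qed.

(** A class that guarantees integrability against the weight and is stable under the operations of
    the proof: it contains the Lipschitz functions and z f(z) for [f] bounded and continuous, and is
    closed under sums, scaling and affine substitution. *)
Definition tame (R : realType) (f : R -> R) :=
  continuous f /\ exists C, forall x, `|f x| <= C * (1 + `|x|).

(** The weight is the square of exp(-x^2/4); one factor absorbs the linear growth, since 1 + |x| <=
    2 + x^2/4 <= 2 exp(x^2/4). *)
Lemma tame_weight_bound (R : realType) (x : R) :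
  (1 + `|x|) * gauss_weight x <= 2 * expR (- (x ^+ 2 / 4)).
Proof.
have e : gauss_weight x = expR (- (x ^+ 2 / 4)) * expR (- (x ^+ 2 / 4)).
  by rewrite -expRD /gauss_weight; congr expR; field.
have h : 1 + x ^+ 2 / 4 <= expR (x ^+ 2 / 4) by exact: expR_ge1Dx.
have h1 : `|x| <= 1 + x ^+ 2 / 4.
  rewrite -(real_normK (num_real x)); have := sqr_ge0 (`|x| / 2 - 1); lra.
have h0 : 0 <= x ^+ 2 by exact: sqr_ge0.
rewrite e mulrA ler_wpM2r ?expR_ge0 // expRN ler_pdivrMr ?expR_gt0 //.
lra.
Qed.
Lemma tame_integrable (R : realType) (f : R -> R) : tame f ->
  lebesgue_measure.-integrable setT (EFin \o (fun x => f x * gauss_weight x)).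
Proof.
move=> [cf [C fC]].
have s2 : Num.sqrt 2 != 0 :> R by rewrite sqrtr_eq0 -ltNge ltr0n.
(* The density of variance 2 is proportional to exp(-x^2/4); [K] turns it into the dominating
   function 2 C exp(-x^2/4). *)
pose K := 2 * C / normal_peak (Num.sqrt 2 : R).
have := integrable_normal_pdf 0 (Num.sqrt 2 : R).
move=> /(integrableZl measurableT K); apply: le_integrable => //.
  apply/measurable_EFinP; apply: continuous_measurable_fun => x.
  by apply: cvgM; [exact: cf|exact: continuous_gauss_weight].
move=> x _; rewrite lee_fin /=.
have p0 : 0 < normal_peak (Num.sqrt 2 : R) by exact: normal_peak_gt0.
have -> : K * normal_pdf 0 (Num.sqrt 2) x = C * (2 * expR (- (x ^+ 2 / 4))).
  rewrite normal_pdfE // /K /normal_fun subr0 sqr_sqrtr //.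
  rewrite (_ : 2 *+ 2 = 4) ?mulNr; last by ring.
  by field; rewrite gt_eqF.
rewrite normrM (gtr0_norm (gauss_weight_gt0 x)).
apply: le_trans (ler_norm _).
apply: (@le_trans _ _ (C * (1 + `|x|) * gauss_weight x)).
  by rewrite ler_wpM2r // ltW // gauss_weight_gt0.
rewrite -mulrA ler_wpM2l ?tame_weight_bound //.
have := le_trans (normr_ge0 _) (fC 0); rewrite normr0 addr0 mulr1; exact.
Qed.

Lemma gaussE_integral (R : realType) (f : R -> R) : tame f ->
  gaussE f = (Num.sqrt (pi *+ 2))^-1 *
    \int[lebesgue_measure]_x (f x * gauss_weight x).
Proof.
move=> tf; have [cf _] := tf.
rewrite /gaussE unlock integral_normal_prob; last exact: continuous_measurable_fun.
rewrite -RintegralZl //; last exact: tame_integrable.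
by congr fine; apply: eq_integral => x _; rewrite normal_pdf_gauss_weight; congr EFin; ring.
Qed.

Lemma gaussE_cst (R : realType) (a : R) : gaussE (fun=> a) = a.
Proof. by rewrite /gaussE expectation_cst. Qed.

Lemma tameD (R : realType) (f g : R -> R) :
  tame f -> tame g -> tame (fun x => f x + g x).
Proof.
move=> [cf [C fC]] [cg [D gD]]; split.
  by move=> x; apply: cvgD; [exact: cf|exact: cg].
exists (C + D) => x; rewrite mulrDl (le_trans (ler_normD _ _))//.
by rewrite lerD.
Qed.

Lemma tameZ (R : realType) (a : R) (f : R -> R) :
  tame f -> tame (fun x => a * f x).
Proof.
move=> [cf [C fC]]; split.
  by move=> x; apply: cvgM; [exact: cvg_cst|exact: cf].
by exists (`|a| * C) => x; rewrite normrM -mulrA ler_wpM2l.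
Qed.

Lemma tame_bounded (R : realType) (C : R) (f : R -> R) :
  continuous f -> (forall x, `|f x| <= C) -> tame f.
Proof.
move=> cf fC; split => //; exists C => x.
rewrite (le_trans (fC x)) // ler_peMr ?lerDl //.
exact: le_trans (fC 0).
Qed.

Lemma tame_cst (R : realType) (a : R) : tame (fun _ : R => a).
Proof. by apply: (@tame_bounded _ `|a|) => // x; exact: cvg_cst. Qed.

Lemma tame_idM (R : realType) (C : R) (f : R -> R) :
  continuous f -> (forall x, `|f x| <= C) -> tame (fun x => x * f x).
Proof.
move=> cf fC; split; first by move=> x; apply: cvgM; [exact: cvg_id|exact: cf].
exists C => x; rewrite normrM mulrC ler_pM // lerDr //.
Qed.

Lemma tame_comp_affine (R : realType) (a b : R) (f : R -> R) :
  tame f -> tame (fun x => f (a + b * x)).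
Proof.
move=> [cf [C fC]]; split.
  move=> x; apply: (@continuous_comp _ _ _ (fun x => a + b * x) f); last exact: cf.
  by apply: cvgD; [exact: cvg_cst|apply: cvgM; [exact: cvg_cst|exact: cvg_id]].
have C0 : 0 <= C.
  by have := le_trans (normr_ge0 _) (fC 0); rewrite normr0 addr0 mulr1; exact.
exists (C * (1 + `|a| + `|b|)) => x; rewrite (le_trans (fC _))// -mulrA ler_wpM2l//.
apply: (@le_trans _ _ (1 + (`|a| + `|b| * `|x|))).
  by rewrite lerD2l -normrM ler_normD.
have := normr_ge0 a; have := normr_ge0 b; have := normr_ge0 x.
nra.
Qed.

Lemma gaussED (R : realType) (f g : R -> R) : tame f -> tame g ->
  gaussE (fun x => f x + g x) = gaussE f + gaussE g.
Proof.
move=> tf tg; rewrite !gaussE_integral //; last exact: tameD.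
rewrite -mulrDr -RintegralD //; try exact: tame_integrable.
by congr (_ * _); apply: eq_Rintegral => x _; rewrite mulrDl.
Qed.

Lemma gaussEZ (R : realType) (a : R) (f : R -> R) : tame f ->
  gaussE (fun x => a * f x) = a * gaussE f.
Proof.
move=> tf; rewrite !gaussE_integral //; last exact: tameZ.
rewrite mulrCA; congr (_ * _); rewrite -RintegralZl //; last exact: tame_integrable.
by apply: eq_Rintegral => x _; rewrite mulrA.
Qed.

Lemma le_gaussE (R : realType) (f g : R -> R) : tame f -> tame g ->
  (forall x, f x <= g x) -> gaussE f <= gaussE g.
Proof.
move=> tf tg fg; rewrite !gaussE_integral // ler_wpM2l ?invr_ge0 ?sqrtr_ge0 //.
apply: le_Rintegral => //; try exact: tame_integrable.
by move=> x _; rewrite ler_wpM2r // ltW // gauss_weight_gt0.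
Qed.

(** * Monotonicity up to infinity and Gaussian integration by parts *)

Lemma le_derive_ge0 (R : realType) (a b : R) (f f' : R -> R) : a <= b ->
  (forall x : R, a <= x <= b -> is_derive x 1 f (f' x)) ->
  (forall x, a <= x <= b -> 0 <= f' x) -> f a <= f b.
Proof.
move=> ab df f'0; rewrite -subr_ge0.
have [||c] := @MVT_segment R f f' a b ab.
- by move=> x; rewrite in_itv /= => /andP[ax xb]; apply: df; rewrite !ltW.
- apply: derivable_within_continuous => x; rewrite in_itv /= => axb.
  exact: (@ex_derive _ _ _ _ _ _ _ (df x axb)).
- by rewrite in_itv /= => acb ->; rewrite mulr_ge0 ?f'0 // subr_ge0.
Qed.

Lemma derive_eq0_cst (R : realType) (f : R -> R) :
  (forall x : R, is_derive x 1 f 0) -> forall x y, f x = f y.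
Proof.
move=> df.
have le x y : x <= y -> f x = f y.
  move=> xy; apply/eqP; rewrite eq_le; apply/andP; split.
    exact: (@le_derive_ge0 _ x y f (fun=> 0)).
  rewrite -lerN2; apply: (@le_derive_ge0 _ x y (fun x => - f x) (fun=> 0)) => // z _.
  by apply: is_derive_eq; rewrite oppr0.
by move=> x y; have [/le ->|/ltW/le ->] := leP x y.
Qed.

Lemma le_lim_pinfty (R : realType) (a l : R) (f f' : R -> R) :
  (forall x : R, a <= x -> is_derive x 1 f (f' x)) ->
  (forall x, a <= x -> 0 <= f' x) -> f x @[x --> +oo] --> l -> f a <= l.
Proof.
move=> df f'0 fl; rewrite -(cvg_lim _ fl) //.
apply: limr_ge; first by apply/cvg_ex; exists l.
near=> x.
have ax : a <= x by near: x; apply: nbhs_pinfty_ge; rewrite num_real.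
by apply: (@le_derive_ge0 _ a x f f') => // t /andP[at_ _]; [exact: df|exact: f'0].
Unshelve. all: by end_near. Qed.

Lemma cvg_weight_bounded (R : realType) (C : R) (f : R -> R) :
  (forall x, `|f x| <= C) -> gauss_weight x * f x @[x --> +oo] --> 0.
Proof.
move=> fC; apply/cvgrPdist_le => e e0; near=> x.
have x0 : 0 < x by near: x; exact: nbhs_pinfty_gt.
have wx : gauss_weight x <= x^-1.
  rewrite /gauss_weight expRN lef_pV2 ?posrE ?expR_gt0 //.
  apply: le_trans (expR_ge1Dx _); have := sqr_ge0 (x - 1); nra.
rewrite sub0r normrN normrM (gtr0_norm (gauss_weight_gt0 _)).
apply: (@le_trans _ _ (x^-1 * C)); first by rewrite ler_pM ?(ltW (gauss_weight_gt0 _)).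
rewrite mulrC ler_pdivrMr // mulrC -ler_pdivrMr //.
Unshelve. all: by end_near. Qed.

Lemma cvgNy_weight_bounded (R : realType) (C : R) (f : R -> R) :
  (forall x, `|f x| <= C) -> gauss_weight x * f x @[x --> -oo] --> 0.
Proof.
move=> fC; apply/cvgNy_compNP.
rewrite (_ : _ \o _ = fun x => gauss_weight x * f (- x)).
  exact: (@cvg_weight_bounded _ C).
by apply/funext => x /=; rewrite gauss_weightN.
Qed.

(** With w the weight, (f' - z f) w is the derivative of w f, which vanishes at both ends. Its
    primitive [F] from -oo thus differs from w f by a constant; the limit at -oo makes this constant
    0, and the limit at +oo is then the integral. *)
Lemma gaussE_derive (R : realType) (C D : R) (f f' : R -> R) :
  (forall x : R, is_derive x 1 f (f' x)) -> continuous f' ->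
  (forall x, `|f x| <= C) -> (forall x, `|f' x| <= D) ->
  gaussE (fun z => z * f z) = gaussE f'.
Proof.
move=> df cf' fC f'D.
have cf := is_derive_continuous df.
have t1 : tame f' := tame_bounded cf' f'D.
have t2 : tame (fun z => -1 * (z * f z)) := tameZ _ (tame_idM cf fC).
suff : gaussE (fun z => f' z + -1 * (z * f z)) = 0.
  rewrite gaussED // gaussEZ; last exact: tame_idM cf fC.
  lra.
rewrite gaussE_integral; last exact: tameD.
have ti := tame_integrable (tameD t1 t2).
have cg : continuous (fun x => (f' x + -1 * (x * f x)) * gauss_weight x).
  by move=> x; apply: cvgM; [exact: (tameD t1 t2).1|exact: continuous_gauss_weight].
have [F [dF F0 Fl]] := improper_primitive cg ti.
have Fc : forall x y, F x - gauss_weight x * f x = F y - gauss_weight y * f y.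
  apply: derive_eq0_cst => x; have := dF x; have := df x => ? ?.
  by apply: is_derive_eq; rewrite /GRing.scale /=; ring.
have E0 x : F x = F 0 - gauss_weight 0 * f 0 + gauss_weight x * f x.
  by rewrite -(Fc x 0) subrK.
have cN : F x @[x --> -oo] --> F 0 - gauss_weight 0 * f 0 + 0.
  under eq_fun do rewrite E0.
  by apply: cvgD; [exact: cvg_cst|exact: cvgNy_weight_bounded fC].
have cP : F x @[x --> +oo] --> F 0 - gauss_weight 0 * f 0 + 0.
  under eq_fun do rewrite E0.
  by apply: cvgD; [exact: cvg_cst|exact: cvg_weight_bounded fC].
by rewrite (cvg_unique _ Fl cP) // (cvg_unique _ cN F0) // mulr0.
Qed.

(** * The primitive of the weight and the inequality behind the constant sqrt(2/pi) *)

Lemma gauss_weight_le1 (R : realType) (x : R) : gauss_weight x <= 1.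
Proof.
by rewrite /gauss_weight -[leRHS]expR0 ler_expR oppr_le0 divr_ge0 ?sqr_ge0.
Qed.

(** The total mass 2 I is read off from the expectation of the constant 1. As the weight is even,
    F(x) + F(-x) is constant, hence equal to 2 I, and F - I is odd. *)
Lemma gauss_primitive (R : realType) : exists N : R -> R,
  [/\ forall x : R, is_derive x 1 N (gauss_weight x),
      forall x, N (- x) = - N x &
      N x @[x --> +oo] --> Num.sqrt (pi / 2)].
Proof.
have t1 := tame_cst (1 : R).
have ti := tame_integrable t1.
have cg : continuous (fun x : R => 1 * gauss_weight x).
  by move=> x; apply: cvgM; [exact: cvg_cst|exact: continuous_gauss_weight].
have [F [dF F0 Fl]] := improper_primitive cg ti.
set I := Num.sqrt _.
have II : \int[lebesgue_measure]_x (1 * gauss_weight x) = 2 * I :> R.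
  have := gaussE_integral t1; rewrite gaussE_cst.
  have -> : Num.sqrt (pi *+ 2) = 2 * I :> R.
    rewrite /I -[X in X * _](@ger0_norm R) // -sqrtr_sqr -sqrtrM ?sqr_ge0 //.
    by congr Num.sqrt; field.
  have I0 : I != 0 by rewrite sqrtr_eq0 -ltNge divr_gt0 ?pi_gt0.
  by move=> /(congr1 (fun y => 2 * I * y)); rewrite mulr1 mulVKf ?mulf_neq0.
have Nc : forall x y, F x + F (- x) = F y + F (- y).
  apply: derive_eq0_cst => x.
  have d1 := dF x; have d2 := dF (- x).
  by apply: is_derive_eq; rewrite gauss_weightN; ring.
have FN x : F x + F (- x) = 2 * I.
  have c1 : F x + F (- x) @[x --> +oo] --> 2 * I + 0.
    by apply: cvgD; [rewrite -II|exact/cvgNy_compNP].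
  move: c1; rewrite addr0; under eq_fun do rewrite (Nc _ x).
  by move=> c1; apply: cvg_unique c1 => //; exact: cvg_cst.
exists (fun x => F x - I); split.
- by move=> x; have := dF x => ?; apply: is_derive_eq; rewrite subr0 mul1r.
- move=> x; have := FN x; lra.
- rewrite -[X in _ --> X](_ : 2 * I - I = I); last by ring.
  by apply: cvgB; [rewrite -II|exact: cvg_cst].
Qed.
Lemma gauss_weight_ge (R : realType) (x : R) : 1 - x ^+ 2 / 2 <= gauss_weight x.
Proof. exact: expR_ge1Dx. Qed.

(* Both sides differ by t^2 (2 pi - 4 - q t), with q nondecreasing because
   exp(-t^2/2) >= 1 - t^2/2. *)
Lemma crossing_sign (R : realType) (x y : R) : 0 < x -> x <= y ->
  (2 + y ^+ 2) ^+ 2 <= 4 * (pi / 2 * y ^+ 2 + gauss_weight y) ->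
  (2 + x ^+ 2) ^+ 2 <= 4 * (pi / 2 * x ^+ 2 + gauss_weight x).
Proof.
move=> x0 xy.
pose q t : R := (4 + t ^+ 4 - 4 * gauss_weight t) / t ^+ 2.
pose q' t : R := (4 * gauss_weight t * (t ^+ 2 + 2) - 8 + 2 * t ^+ 4) / t ^+ 3.
have : q x <= q y.
  apply: (@le_derive_ge0 _ x y q q' xy) => t /andP[xt _].
    have t0 : t != 0 by rewrite gt_eqF // (lt_le_trans x0).
    have t20 : t ^+ 2 != 0 by rewrite expf_neq0.
    by apply: is_derive_eq; rewrite /q' /GRing.scale /=; field.
  have t0 : 0 < t by rewrite (lt_le_trans x0).
  rewrite divr_ge0 ?exprn_ge0 ?(ltW t0) //.
  have := gauss_weight_ge t; have := sqr_ge0 t.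
  rewrite (_ : t ^+ 4 = t ^+ 2 * t ^+ 2); [nra|ring].
have e t : 0 < t ->
    ((2 + t ^+ 2) ^+ 2 <= 4 * (pi / 2 * t ^+ 2 + gauss_weight t)) =
    (q t <= 2 * pi - 4).
  move=> t0; rewrite /q ler_pdivrMr ?exprn_gt0 // -subr_ge0 -[RHS]subr_ge0.
  by congr (_ <= _); field.
by rewrite !e ?(lt_le_trans x0) //; exact: le_trans.
Qed.
Lemma weight_primitive_le (R : realType) (N : R -> R) (x : R) :
  (forall x : R, is_derive x 1 N (gauss_weight x)) -> (forall x, N (- x) = - N x) ->
  N x @[x --> +oo] --> Num.sqrt (pi / 2) -> 0 <= x ->
  (gauss_weight x + x * N x) ^+ 2 <= pi / 2 * x ^+ 2 + gauss_weight x.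
Proof.
move=> dN NN Nl; rewrite le_eqVlt => /predU1P[<-|x0].
  by rewrite mul0r addr0 expr0n mulr0 add0r /gauss_weight expr0n mul0r oppr0 expR0 expr1n.
have p2 : 0 < pi / 2 :> R by rewrite divr_gt0 ?pi_gt0.
have NI (t : R) : N t <= Num.sqrt (pi / 2).
  by apply: (le_lim_pinfty (fun z _ => dN z) _ Nl) => z _; rewrite ltW ?gauss_weight_gt0.
have N0 : N 0 = 0 by have := NN 0; rewrite oppr0; lra.
have N_ge0 (t : R) : 0 <= t -> 0 <= N t.
  move=> t0; rewrite -N0; apply: (le_derive_ge0 t0 (fun z _ => dN z)) => z _.
  by rewrite ltW ?gauss_weight_gt0.
have N_le (t : R) : 0 <= t -> N t <= t.
  move=> t0; rewrite -subr_ge0 -[leLHS](_ : 0 - N 0 = 0); last by rewrite N0 subr0.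
  apply: (le_derive_ge0 (f := fun t : R => t - N t)
    (f' := fun t : R => 1 - gauss_weight t) t0) => z _.
  by rewrite subr_ge0 gauss_weight_le1.
(* The claim is 0 <= r x.  Since r' has the sign of 4 W t - (2 + t^2)^2, the
   function r first increases, then decreases, and it tends to 0 both at 0 and
   at +oo. *)
pose W (t : R) : R := pi / 2 * t ^+ 2 + gauss_weight t.
pose U (t : R) : R := Num.sqrt (W t).
have W0 (t : R) : 0 < W t by rewrite ltr_wpDl ?gauss_weight_gt0 // mulr_ge0 ?sqr_ge0 ?ltW.
have U0 (t : R) : 0 < U t by rewrite sqrtr_gt0.
have U2 (t : R) : U t ^+ 2 = W t by rewrite sqr_sqrtr // ltW.
pose r (t : R) : R := (U t - gauss_weight t) / t - N t.
pose r' (t : R) : R := gauss_weight t * (2 * U t - (2 + t ^+ 2)) / (2 * U t * t ^+ 2).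
have dr (t : R) : 0 < t -> is_derive t 1 r (r' t).
  move=> t0; have dW : is_derive t 1 W (pi * t - t * gauss_weight t).
    by apply: is_derive_eq; rewrite /GRing.scale /=; field.
  have dU : is_derive t 1 U ((2 * U t)^-1 * (pi * t - t * gauss_weight t)).
    have := is_derive1_sqrt (W0 t) => ?.
    by rewrite /U; apply: is_derive_eq; rewrite mulrC.
  have t_neq0 : t != 0 by rewrite gt_eqF.
  have U_neq0 : U t != 0 by rewrite gt_eqF.
  have dV := @is_deriveV R id t 1 1 t_neq0 (is_derive_id t 1).
  have dw := is_derive_gauss_weight t.
  apply: (is_derive_eq (is_deriveB (is_deriveM (is_deriveB dU dw) dV) (dN t))).
  rewrite /r' /GRing.scale /=.
  have Ut := U2 t; clearbody U.
  change ((U t - gauss_weight t) * (- t ^- 2 * 1)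
      + t^-1 * ((2 * U t)^-1 * (pi * t - t * gauss_weight t)
                - - t * gauss_weight t) - gauss_weight t
    = gauss_weight t * (2 * U t - (2 + t ^+ 2)) / (2 * U t * t ^+ 2)).
  (* Eliminating [pi] through U^2 = W leaves an identity of rational functions of t, U and the
     weight. *)
  have -> : (pi : R) = 2 * (U t ^+ 2 - gauss_weight t) / t ^+ 2 by rewrite Ut /W; field.
  by field; rewrite t_neq0.
have r'_sign (t : R) : 0 < t -> (0 <= r' t) = ((2 + t ^+ 2) ^+ 2 <= 4 * W t).
  move=> t0; rewrite /r' pmulr_lge0 ?invr_gt0 ?mulr_gt0 ?exprn_gt0 //.
  rewrite pmulr_rge0 ?gauss_weight_gt0 // subr_ge0 -U2.
  rewrite (_ : 4 * _ = (2 * U t) ^+ 2); last by ring.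
  by rewrite ler_sqr // nnegrE ?addr_ge0 ?sqr_ge0 ?mulr_ge0 // ltW.
suff rx : 0 <= r x.
  rewrite -[leRHS]U2 ler_sqr ?nnegrE ?(ltW (U0 _)) ?addr_ge0 ?mulr_ge0
    ?N_ge0 ?(ltW x0) ?(ltW (gauss_weight_gt0 _)) //.
  by move: rx; rewrite /r subr_ge0 ler_pdivlMr //; lra.
rewrite leNgt; apply/negP => rx.
have [kx|kx] := leP ((2 + x ^+ 2) ^+ 2) (4 * W x).
  (* Increasing branch: r e <= r x, whereas r e >= - e >= r x / 2 > r x, as r x < 0. *)
  pose e := Num.min x (- r x / 2).
  have e0 : 0 < e by rewrite lt_min x0 /= divr_gt0 // oppr_gt0.
  have ex : e <= x by rewrite ge_min lexx.
  have er : e <= - r x / 2 by rewrite ge_min lexx orbT.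
  have rex : r e <= r x.
    apply: (@le_derive_ge0 _ e x r r' ex) => t /andP[et tx].
      by apply: dr; exact: lt_le_trans et.
    by rewrite r'_sign ?(lt_le_trans e0) //; apply: crossing_sign tx kx; exact: lt_le_trans et.
  have : - e <= r e.
    rewrite /r -[leLHS]add0r lerD ?lerN2 ?N_le ?(ltW e0) // divr_ge0 ?(ltW e0) //.
    rewrite subr_ge0 -ler_sqr ?nnegrE ?(ltW (U0 _)) ?(ltW (gauss_weight_gt0 _)) //.
    rewrite U2 /W expr2.
    have := gauss_weight_le1 e; have := gauss_weight_gt0 e; have := sqr_ge0 e; nra.
  lra.
(* Decreasing branch: - 1 / y <= r y <= r x would give y (- r x) <= 1, while this choice of [y]
   makes the product 1 + x (- r x) > 1. *)
pose y := x - (r x)^-1.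
have xy : x <= y by rewrite lerBrDr gerDl invr_le0 ltW.
have y0 : 0 < y := lt_le_trans x0 xy.
have ryx : r y <= r x.
  rewrite -lerN2.
  apply: (@le_derive_ge0 _ x y (fun t : R => - r t) (fun t : R => - r' t) xy) => t /andP[xt ty].
    have := dr t (lt_le_trans x0 xt); move: (r) (r') => f f' ?.
    by apply: is_derive_eq.
  rewrite oppr_ge0 leNgt; apply/negP => /ltW; rewrite r'_sign ?(lt_le_trans x0) // => kt.
  by move: kx; rewrite ltNge => /negP; apply; exact: crossing_sign kt.
have ry : - y^-1 <= r y.
  (* With N y <= sqrt(pi/2) and a weight at most 1, this leaves only - 1 / y as a lower bound of r
     y. *)
  have UI : Num.sqrt (pi / 2) * y <= U y.
    rewrite -ler_sqr ?nnegrE ?(ltW (U0 _)) ?mulr_ge0 ?sqrtr_ge0 ?(ltW y0) //.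
    by rewrite exprMn sqr_sqrtr ?(ltW p2) // U2 /W lerDl ltW ?gauss_weight_gt0.
  have : Num.sqrt (pi / 2) - y^-1 <= (U y - gauss_weight y) / y.
    rewrite ler_pdivlMr // mulrBl mulVf ?gt_eqF //.
    have := gauss_weight_le1 y; lra.
  by have := NI y; rewrite /r; lra.
have : y * - r x <= 1.
  by rewrite -ler_pdivlMl // mulr1 lerNl; exact: le_trans ryx.
rewrite /y mulrBl mulrN mulrN mulVf ?lt_eqF // opprK.
have : 0 < x * - r x by rewrite mulr_gt0 // oppr_gt0.
lra.
Qed.

(** * The rescaled Stein equation: comparison principle and derivative bounds *)

(** The Stein equation for mu = 0 and sigma = 1, with the Gaussian mean already absorbed into [k].
    The derivative is always spelled x f(x) + k(x), so bounds on it are stated in this form. *)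
Definition std_stein (R : realType) (k f : R -> R) : Prop :=
  (exists C, forall x, `|f x| <= C) /\
  forall x : R, is_derive x 1 f (x * f x + k x).

Lemma std_stein_opp (R : realType) (k f : R -> R) :
  std_stein k f -> std_stein (fun x => - k x) (fun x => - f x).
Proof.
move=> [[C fC] df]; split; first by exists C => x; rewrite normrN.
by move=> x; have := df x => ?; apply: is_derive_eq; ring.
Qed.

(** This symmetry exchanges left and right half lines, as [std_stein_opp] exchanges upper and lower
    bounds; comparison is therefore needed only towards +oo. *)
Lemma std_stein_flip (R : realType) (k f : R -> R) :
  std_stein k f -> std_stein (fun x => k (- x)) (fun x => - f (- x)).
Proof.
move=> [[C fC] df]; split; first by exists C => x; rewrite normrN.
by move=> x; have := df (- x) => ?; apply: is_derive_eq; ring.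
Qed.

Lemma weighted_derive (R : realType) (k f : R -> R) (x : R) :
  std_stein k f ->
  is_derive x 1 (fun x => gauss_weight x * f x) (gauss_weight x * k x).
Proof.
by move=> [_ df]; have := df x => ?; apply: is_derive_eq; rewrite /GRing.scale /=; ring.
Qed.

(** The difference of the weighted solution and [w] is nondecreasing to the right of [a] and tends
    to 0 at +oo, so it is nonpositive at [a]. *)
Lemma std_stein_le (R : realType) (k f w w' : R -> R) (a : R) :
  std_stein k f -> (forall x : R, is_derive x 1 w (w' x)) ->
  w x @[x --> +oo] --> 0 ->
  (forall x, a <= x -> w' x <= gauss_weight x * k x) ->
  gauss_weight a * f a <= w a.
Proof.
move=> sf dw w0 w'k; rewrite -subr_le0.
have df := fun x => weighted_derive x sf.
have [[C fC] _] := sf.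
have dg (x : R) : is_derive x 1 (fun x => gauss_weight x * f x - w x)
    (gauss_weight x * k x - w' x).
  by have := df x; have := dw x => ? ?; apply: is_derive_eq.
apply: (le_lim_pinfty (fun x _ => dg x)) => [x ax|]; first by rewrite subr_ge0 w'k.
rewrite -[X in _ --> X](subrr 0).
by apply: cvgB => //; exact: cvg_weight_bounded fC.
Qed.

Lemma std_stein_ge (R : realType) (k f w w' : R -> R) (a : R) :
  std_stein k f -> (forall x : R, is_derive x 1 w (w' x)) ->
  w x @[x --> +oo] --> 0 ->
  (forall x, a <= x -> gauss_weight x * k x <= w' x) ->
  w a <= gauss_weight a * f a.
Proof.
move=> sf dw w0 w'k; rewrite -lerN2 -mulrN.
have dNw (x : R) : is_derive x 1 (fun x => - w x) (- w' x).
  by have := dw x => ?; apply: is_derive_eq.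
have Nw0 : - w x @[x --> +oo] --> 0 by rewrite -oppr0; exact: cvgN.
apply: (std_stein_le (std_stein_opp sf) dNw Nw0) => x ax.
by rewrite mulrN lerN2 w'k.
Qed.

(** The constant [c] solves the equation whose right-hand side is - x c, so it can serve as a
    supersolution. *)
Lemma std_stein_le_cst (R : realType) (k f : R -> R) (a c : R) :
  std_stein k f -> (forall x, a <= x -> - (x * c) <= k x) -> f a <= c.
Proof.
move=> sf kc; rewrite -(ler_pM2l (gauss_weight_gt0 a)).
apply: (@std_stein_le _ k f (fun x => gauss_weight x * c)
  (fun x => gauss_weight x * - (x * c))) => // [x||x ax].
- by apply: is_derive_eq; rewrite /GRing.scale /=; ring.
- exact: (@cvg_weight_bounded _ `|c|).
- by rewrite ler_wpM2l ?kc // ltW ?gauss_weight_gt0.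
Qed.

Lemma std_stein_ge_cst (R : realType) (k f : R -> R) (a c : R) :
  std_stein k f -> (forall x, a <= x -> k x <= - (x * c)) -> c <= f a.
Proof.
move=> sf kc; rewrite -lerN2; apply: (std_stein_le_cst (std_stein_opp sf)) => x ax.
by rewrite mulrN lerN2 kc.
Qed.

(** [kap] is the value at 0 of the supporting line of k at x. If kap <= 0 < x, then on [x, +oo) this
    line lies above the line through the origin that meets it at x, and comparison with a constant
    gives f(x) <= - k(x) / x. *)
Lemma std_stein_derive_le0 (R : realType) (k f : R -> R) (x : R) :
  (forall a, exists p, forall t, k a + p * (t - a) <= k t) ->
  std_stein k f -> x * f x + k x <= 0.
Proof.
wlog x0 : k f x / 0 <= x.
  move=> wl kp sf; have [/wl|x0] := leP 0 x; first exact.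
  have := @wl (fun x => k (- x)) (fun x => - f (- x)) (- x).
  rewrite oppr_ge0 (ltW x0) opprK mulrNN; apply => //; last exact: std_stein_flip.
  move=> a; have [p kap] := kp (- a); exists (- p) => t.
  by rewrite (_ : - p * (t - a) = p * (- t - - a)); [exact: kap|ring].
move=> kp sf; have [p kxp] := kp x.
pose kap := k x - p * x.
have [kap0|kap0] := leP kap 0.
  have := x0; rewrite le_eqVlt => /predU1P[x00|x_gt0].
    by move: kap0; rewrite /kap -x00; lra.
  have fx : f x <= - p - kap / x.
    apply: (std_stein_le_cst sf) => t xt; apply: le_trans (kxp t).
    have : kap * (t / x) <= kap * 1 by rewrite ler_wnM2l // ler_pdivlMr ?mul1r.
    rewrite /kap; lra.
  have : x * f x <= x * (- p - kap / x) by rewrite ler_wpM2l.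
  rewrite mulrBr mulrCA divff ?gt_eqF // /kap; lra.
(* If kap > 0, comparing with the constant - p from both sides makes f
   constant. *)
have fE a : f a = - p.
  apply/eqP; rewrite eq_le; apply/andP; split.
    apply: (std_stein_le_cst sf) => t _; apply: le_trans (kxp t).
    by move: kap0; rewrite /kap; lra.
  rewrite -[leLHS]opprK -[leRHS]opprK lerN2 -[a]opprK.
  apply: (std_stein_le_cst (std_stein_flip sf)) => t _.
  by apply: le_trans (kxp (- t)); move: kap0; rewrite /kap; lra.
have fc : f = cst (- p) by apply/funext => a; exact: fE.
have := sf.2 x; rewrite {1}fc => /(@derive_val _ _ _ _ _ _ _) <-.
by rewrite derive_cst.
Qed.

(** As k(t) - t is nonincreasing, either k(t) <= t for all t >= x or k(t) >= t for all t <= x; on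
    that half line the solution is compared with the constant -1. *)
Lemma std_stein_ge_opp1 (R : realType) (k f : R -> R) (x : R) :
  (forall a b, `|k a - k b| <= `|a - b|) -> std_stein k f -> - 1 <= f x.
Proof.
move=> kl sf.
have [kx|kx] := leP (k x) x.
  apply: (std_stein_ge_cst sf) => t xt.
  have := kl t x; rewrite (ger0_norm (_ : 0 <= t - x)) ?subr_ge0 // ler_norml => /andP[_]; lra.
rewrite -[leRHS]opprK lerN2 -[x]opprK.
apply: (std_stein_le_cst (std_stein_flip sf)) => t xt.
have tx : 0 <= x - - t by lra.
have := kl x (- t); rewrite (ger0_norm tx) ler_norml => /andP[_]; lra.
Qed.

(* The bound concerns (x f)'; as f' = x f + k, it makes f' 2-Lipschitz. *)
Lemma std_stein_idM_derive_ge (R : realType) (k f : R -> R) (x : R) :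
  (forall a b, `|k a - k b| <= `|a - b|) -> std_stein k f ->
  - 1 <= f x + x * (x * f x + k x).
Proof.
wlog x0 : k f x / 0 <= x.
  move=> wl kl sf; have [/wl|x0] := leP 0 x; first exact.
  have kl' a b : `|- k (- a) - - k (- b)| <= `|a - b|.
    by rewrite -opprD normrN (le_trans (kl _ _)) // -opprD normrN.
  have Nx0 : 0 <= - x by rewrite oppr_ge0 ltW.
  have := wl _ _ _ Nx0 kl' (std_stein_opp (std_stein_flip sf)).
  rewrite /= !opprK (_ : - x * _ = x * (x * f x + k x)) //; ring.
move=> kl sf.
have f1 := std_stein_ge_opp1 x kl sf.
have [kx|kx] := leP x (k x).
  have : x * x <= x * k x by rewrite ler_wpM2l.
  have : 0 <= x ^+ 2 by exact: sqr_ge0.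
  rewrite expr2; nra.
pose c := k x - x.
have c0 : c < 0 by rewrite subr_lt0.
(* t / (1 + t^2) is the classical lower bound of the Mills ratio. *)
pose u t : R := - 1 - c * t / (1 + t ^+ 2).
have D0 (t : R) : 0 < 1 + t ^+ 2 by rewrite ltr_wpDr ?sqr_ge0.
have D_neq0 (t : R) : 1 + t ^+ 2 != 0 by rewrite gt_eqF.
pose w' t : R := gauss_weight t * (t + c * (1 - 2 / (1 + t ^+ 2) ^+ 2)).
have dw (t : R) : is_derive t 1 (fun t => gauss_weight t * u t) (w' t).
  have := D_neq0 t => ?; rewrite /u /w'.
  apply: is_derive_eq; rewrite /GRing.scale /=.
  by field.
have uC t : `|u t| <= 1 + `|c|.
  rewrite /u -opprD normrN (le_trans (ler_normD _ _)) // normr1 lerD2l -mulrA normrM.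
  rewrite ler_piMr // normrM normfV (gtr0_norm (D0 t)) ler_pdivrMr // mul1r.
  by rewrite -(real_normK (num_real t)); have := sqr_ge0 (`|t| - 1); have := normr_ge0 t; nra.
(* Since c < 0, [w'] is at least the weight times t + c, and k(t) <= t + c on [x, +oo). Multiplied
   by 1 + x^2, the bound u x <= f x is exactly the claim. *)
have : gauss_weight x * u x <= gauss_weight x * f x.
  apply: (std_stein_ge sf dw (cvg_weight_bounded uC)) => t xt.
  rewrite ler_wpM2l ?(ltW (gauss_weight_gt0 _)) //.
  have kt : k t <= t + c.
    have := kl t x; rewrite (ger0_norm (_ : 0 <= t - x)) ?subr_ge0 // ler_norml => /andP[_].
    rewrite /c; lra.
  apply: le_trans kt _; rewrite lerD2l -[leLHS]mulr1 ler_wnM2l ?(ltW c0) //.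
  by rewrite gerBl divr_ge0 // sqr_ge0.
rewrite ler_pM2l ?gauss_weight_gt0 // /u => ux.
have : (1 + x ^+ 2) * (- 1 - c * x / (1 + x ^+ 2)) <= (1 + x ^+ 2) * f x.
  by rewrite ler_wpM2l // ltW.
rewrite mulrBr mulrCA divff // /c expr2; lra.
Qed.
Lemma cvg_weight (R : realType) : @gauss_weight R x @[x --> +oo] --> 0.
Proof.
rewrite (_ : @gauss_weight R = fun x => gauss_weight x * 1).
  by apply: (@cvg_weight_bounded _ 1) => x; rewrite normr1.
by apply/funext => x; rewrite mulr1.
Qed.

(** On [x, +oo) one has k(t) <= t + (k(x) - x). The comparison function is the primitive, vanishing
    at +oo, of the weight times this affine majorant. *)
Lemma std_stein_weighted_ge (R : realType) (k f N : R -> R) (x : R) :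
  (forall x : R, is_derive x 1 N (gauss_weight x)) ->
  N x @[x --> +oo] --> Num.sqrt (pi / 2) ->
  (forall a b, `|k a - k b| <= `|a - b|) -> std_stein k f ->
  - gauss_weight x - (k x - x) * (Num.sqrt (pi / 2) - N x) <= gauss_weight x * f x.
Proof.
move=> dN Nl kl sf.
apply: (@std_stein_ge _ k f
  (fun t => - gauss_weight t - (k x - x) * (Num.sqrt (pi / 2) - N t))
  (fun t => gauss_weight t * (t + (k x - x)))) => // [t||t xt].
- by have := dN t => ?; apply: is_derive_eq; rewrite /GRing.scale /=; ring.
- rewrite (_ : 0 = - 0 - (k x - x) * (Num.sqrt (pi / 2) - Num.sqrt (pi / 2))); last by ring.
  apply: cvgB.
    by apply: cvgN; exact: cvg_weight.
  by apply: cvgM; [exact: cvg_cst|apply: cvgB; [exact: cvg_cst|exact: Nl]].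
- rewrite ler_wpM2l ?(ltW (gauss_weight_gt0 _)) //.
  have := kl t x; rewrite (ger0_norm (_ : 0 <= t - x)) ?subr_ge0 // ler_norml => /andP[_]; lra.
Qed.

Lemma sqrt_pi2_gt0 (R : realType) : 0 < Num.sqrt (pi / 2) :> R.
Proof. by rewrite sqrtr_gt0 divr_gt0 ?pi_gt0. Qed.

(** Comparison on both half lines bounds f(x) from below and from above. Eliminating f(x) bounds
    k(x) from below, and inserting this into the lower bound of f(x) leads to
    [weight_primitive_le]. *)
Lemma std_stein_derive_ge (R : realType) (k f : R -> R) (x : R) :
  (forall a b, `|k a - k b| <= `|a - b|) -> std_stein k f ->
  - Num.sqrt (2 / pi) <= x * f x + k x.
Proof.
wlog x0 : k f x / 0 <= x.
  move=> wl kl sf; have [/wl|x0] := leP 0 x; first exact.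
  have kl' a b : `|k (- a) - k (- b)| <= `|a - b|.
    by rewrite (le_trans (kl _ _)) // -opprD normrN.
  have Nx0 : 0 <= - x by rewrite oppr_ge0 ltW.
  have := wl _ _ _ Nx0 kl' (std_stein_flip sf).
  by rewrite opprK mulrNN.
move=> kl sf; have [N [dN NN Nl]] := gauss_primitive R.
have p2 : 0 < pi / 2 :> R by rewrite divr_gt0 ?pi_gt0.
have I0 := sqrt_pi2_gt0 R.
have II : Num.sqrt (pi / 2) ^+ 2 = pi / 2 :> R by rewrite sqr_sqrtr // ltW.
have -> : Num.sqrt (2 / pi) = (Num.sqrt (pi / 2))^-1 :> R.
  by rewrite -sqrtrV ?(ltW p2) // invf_div.
have lo := std_stein_weighted_ge x dN Nl kl sf.
have kl' a b : `|k (- a) - k (- b)| <= `|a - b|.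
  by rewrite (le_trans (kl _ _)) // -opprD normrN.
have := std_stein_weighted_ge (- x) dN Nl kl' (std_stein_flip sf).
rewrite /= !opprK gauss_weightN NN mulrN => hi.
have key := weight_primitive_le dN NN Nl x0.
have E0 := gauss_weight_gt0 x.
rewrite -II in key.
(* The upper bound of the Mills ratio: for t >= x > 0 the weight is at most t / x times itself, and
   the latter has integral w(x) / x over [x, +oo). *)
have a0 : 0 <= gauss_weight x - x * (Num.sqrt (pi / 2) - N x).
  have := x0; rewrite le_eqVlt => /predU1P[<-|x_gt0].
    by rewrite mul0r subr0 ltW ?gauss_weight_gt0.
  have dM (t : R) : is_derive t 1 (fun t => - (N t + gauss_weight t / x))
      (gauss_weight t * (t / x - 1)).
    by have := dN t => ?; apply: is_derive_eq; rewrite /GRing.scale /=; field; rewrite gt_eqF.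
  have : - (N x + gauss_weight x / x) <= - (Num.sqrt (pi / 2) + 0 / x).
    apply: (le_lim_pinfty (fun t _ => dM t)) => [t xt|].
      by rewrite mulr_ge0 ?(ltW (gauss_weight_gt0 _)) // subr_ge0 ler_pdivlMr ?mul1r.
    apply: cvgN; apply: cvgD => //; apply: cvgM; [exact: cvg_weight|exact: cvg_cst].
  rewrite mul0r addr0 lerN2 -lerBlDl ler_pdivlMr //; lra.
move: (gauss_weight x) (Num.sqrt _) (N x) (k x) (f x) E0 I0 lo hi key a0.
move=> E I n A F E0 I0 lo hi key a0.
(* A lower bound on k x, from the comparison on both half lines. *)
have AI : - (E + x * n) <= I * A by nra.
have h1 : (A - x) * (E - x * (I - n)) <= E * (x * F + A).
  have : x * (- E - (A - x) * (I - n)) <= x * (E * F) by rewrite ler_wpM2l.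
  nra.
have h2 : - (E + x * n + x * I) * (E - x * (I - n)) <= I * (A - x) * (E - x * (I - n)).
  by rewrite ler_wpM2r //; lra.
(* The product in [h2] is minus the difference of squares (E + x n)^2 - (x I)^2, which [key] bounds
   by E. *)
have h3 : - E <= I * (E * (x * F + A)).
  apply: le_trans (_ : I * ((A - x) * (E - x * (I - n))) <= _); last by rewrite ler_pM2l.
  rewrite mulrA; apply: le_trans h2; lra.
rewrite lerNl -(ler_pM2l I0) divff ?gt_eqF // mulrN lerNl.
by rewrite -(ler_pM2l E0) mulrN1 mulrCA.
Qed.

(** One unit of the constant 2 comes from k, the other from x f(x), whose derivative lies in [-1, 1]
    by [std_stein_idM_derive_ge] applied to k and to -k. *)
Lemma std_stein_derive_lipschitz (R : realType) (k f : R -> R) (x y : R) :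
  (forall a b, `|k a - k b| <= `|a - b|) -> std_stein k f ->
  `|(x * f x + k x) - (y * f y + k y)| <= 2 * `|x - y|.
Proof.
move=> kl sf.
have bnd t : `|f t + t * (t * f t + k t)| <= 1.
  rewrite ler_norml std_stein_idM_derive_ge //=.
  have kl' a b : `|- k a - - k b| <= `|a - b| by rewrite -opprD normrN.
  have := std_stein_idM_derive_ge t kl' (std_stein_opp sf); lra.
have dg (t : R) : is_derive t 1 (fun t => t * f t) (f t + t * (t * f t + k t)).
  by have := sf.2 t => ?; apply: is_derive_eq; rewrite /GRing.scale /=; ring.
have le1 a b : a <= b -> `|b * f b - a * f a| <= b - a.
  move=> ab.
  have := @MVT_segment R (fun t => t * f t) (fun t => f t + t * (t * f t + k t)) a b ab.
  case=> [|c _ ->].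
    by apply: continuous_subspaceT; exact: (is_derive_continuous dg).
  by rewrite normrM (ger0_norm (_ : 0 <= b - a)) ?subr_ge0 // ler_piMl ?subr_ge0.
have le2 : `|x * f x - y * f y| <= `|x - y|.
  have [xy|/ltW xy] := leP x y.
    by rewrite distrC [leRHS]distrC (ger0_norm (_ : 0 <= y - x)) ?subr_ge0 // le1.
  by rewrite (ger0_norm (_ : 0 <= x - y)) ?subr_ge0 // le1.
rewrite opprD addrACA (le_trans (ler_normD _ _)) // mulr2n mulrDl mul1r lerD ?kl //.
Qed.

(** * Existence of a bounded solution *)

Lemma lipschitz_tame (R : realType) (k : R -> R) :
  (forall a b, `|k a - k b| <= `|a - b|) -> tame k.
Proof.
move=> kl; split.
  move=> x; apply/cvgrPdist_le => e e0; near=> t.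
  by apply: le_trans (kl _ _) _; near: t; apply: cvgr_dist_le.
exists (1 + `|k 0|) => x.
have := kl x 0; rewrite subr0 => h.
have : `|k x| <= `|k x - k 0| + `|k 0| by rewrite -[in leLHS](subrK (k 0) (k x)) ler_normD.
have := normr_ge0 x; have := normr_ge0 (k 0); nra.
Unshelve. all: by end_near. Qed.

(** For t >= |k(0)| the Lipschitz bound gives |k(t)| <= |k(0)| + t <= 2 t, and -2 w is a primitive
    of 2 t w, where w is the weight. *)
Lemma primitive_tail_bound (R : realType) (k F : R -> R) (x : R) :
  (forall a b, `|k a - k b| <= `|a - b|) ->
  (forall x : R, is_derive x 1 F (gauss_weight x * k x)) ->
  F x @[x --> +oo] --> 0 -> `|k 0| <= x -> `|F x| <= 2 * gauss_weight x.
Proof.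
wlog suff : k F / (forall a b, `|k a - k b| <= `|a - b|) ->
  (forall x : R, is_derive x 1 F (gauss_weight x * k x)) ->
  F x @[x --> +oo] --> 0 -> `|k 0| <= x -> F x <= 2 * gauss_weight x.
  move=> wl kl dF F0 kx; rewrite ler_norml wl // andbT lerNl.
  apply: (wl (fun t => - k t) (fun t => - F t)) => //.
  - by move=> a b; rewrite -opprD normrN.
  - by move=> t; have := dF t => ?; apply: is_derive_eq; ring.
  - by rewrite -oppr0; exact: cvgN.
  - by rewrite normrN.
move=> kl dF F0 kx.
have dG (t : R) : is_derive t 1 (fun t => F t - 2 * gauss_weight t)
    (gauss_weight t * (k t + 2 * t)).
  by have := dF t => ?; apply: is_derive_eq; rewrite /GRing.scale /=; ring.
rewrite -subr_le0; apply: (le_lim_pinfty (fun t _ => dG t)) => [t xt|].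
  rewrite mulr_ge0 ?(ltW (gauss_weight_gt0 _)) //.
  have k0 := normr_ge0 (k 0); have Nk0 := ler_norm (- k 0); rewrite normrN in Nk0.
  have t0 : 0 <= t := le_trans k0 (le_trans kx xt).
  have := kl t 0; rewrite subr0 (ger0_norm t0).
  by rewrite ler_norml => /andP[+ _]; lra.
rewrite -[X in _ --> X](_ : 0 - 2 * 0 = 0); last by rewrite mulr0 subr0.
by apply: (cvgB F0); apply: cvgM; [exact: cvg_cst|exact: cvg_weight].
Qed.

(** The solution is F / w with [F] a primitive of w k. Mean zero makes [F] vanish at both ends, so
    the tail bound gives |f| <= 2 outside [-|k(0)|, |k(0)|], and continuity bounds f on this compact
    interval. *)
Lemma std_stein_exists (R : realType) (k : R -> R) :
  (forall a b, `|k a - k b| <= `|a - b|) -> gaussE k = 0 ->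
  exists f, std_stein k f.
Proof.
move=> kl k0; have tk := lipschitz_tame kl.
have ik : \int[lebesgue_measure]_x (k x * gauss_weight x) = 0 :> R.
  move: k0; rewrite gaussE_integral // => /eqP; rewrite mulf_eq0 invr_eq0.
  by rewrite sqrtr_eq0 leNgt mulrn_wgt0 ?pi_gt0 //= => /eqP.
have cg : continuous (fun x => k x * gauss_weight x).
  by move=> x; apply: cvgM; [exact: tk.1|exact: continuous_gauss_weight].
have [F [dF FN FP]] := improper_primitive cg (tame_integrable tk).
rewrite ik in FP.
have dF' (x : R) : is_derive x 1 F (gauss_weight x * k x) by rewrite mulrC.
pose f x := F x / gauss_weight x.
have df (x : R) : is_derive x 1 f (x * f x + k x).
  have w0 : gauss_weight x != 0 by rewrite gt_eqF ?gauss_weight_gt0.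
  have dV := @is_deriveV R (@gauss_weight R) x _ 1 w0 (is_derive_gauss_weight x).
  apply: (is_derive_eq (is_deriveM (dF x) dV)).
  by rewrite /f /GRing.scale /=; field.
exists f; split => //.
have bndP x : `|k 0| <= x -> `|f x| <= 2.
  move=> kx; rewrite normrM normfV (gtr0_norm (gauss_weight_gt0 x)).
  by rewrite ler_pdivrMr ?gauss_weight_gt0 //; exact: primitive_tail_bound kx.
have bndN x : x <= - `|k 0| -> `|f x| <= 2.
  move=> kx; rewrite normrM normfV (gtr0_norm (gauss_weight_gt0 x)).
  rewrite ler_pdivrMr ?gauss_weight_gt0 // -gauss_weightN.
  have := @primitive_tail_bound _ (fun t => - k (- t)) (fun t => F (- t)) (- x).
  rewrite opprK oppr0 normrN; apply.
  - by move=> a b; rewrite -opprD normrN (le_trans (kl _ _)) // -opprD normrN.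
  - by move=> t; have := dF' (- t) => ?; apply: is_derive_eq; rewrite gauss_weightN; ring.
  - exact/cvgNy_compNP.
  - by rewrite lerNr.
have cf := is_derive_continuous df.
have Nkk : - `|k 0| <= `|k 0| by rewrite ge0_cp // oppr_le0.
have [|c _ fc] := @EVT_max R (fun x => `|f x|) _ _ Nkk.
  apply: continuous_subspaceT => x.
  by apply: (@continuous_comp _ _ _ f Num.norm); [exact: cf|exact: norm_continuous].
exists (2 + `|f c|) => x.
have [xk|xk] := leP x (- `|k 0|); first by rewrite ler_wpDr ?bndN.
have [kx|kx] := leP `|k 0| x; first by rewrite ler_wpDr ?bndP.
by rewrite ler_wpDl // fc // in_itv /= !ltW.
Qed.

(** * Supporting lines, and rescaling to arbitrary mu and sigma *)

(** The slope is the supremum of the secant slopes on the left of [a]; by convexity each secant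
    slope on the right is an upper bound of them. *)
Lemma convex_subgradient (R : realType) (h : R -> R) (a : R) :
  convex_function [set: R^o] h -> exists p, forall t, h a + p * (t - a) <= h t.
Proof.
move=> ch.
have cvx (x y l : R) : 0 <= l <= 1 -> h (l * x + (1 - l) * y) <= l * h x + (1 - l) * h y.
  move=> /andP[l0 l1].
  have i01 : Itv.spec (@Itv.num_sem R) (Itv.Real `[0%Z, 1%Z]) l.
    by apply/and3P; split => //=; rewrite ?num_real //.
  have := ch (Itv.mk i01) x y; rewrite !in_setT => /(_ isT isT).
  by rewrite !convRE.
pose slope s := (h a - h s) / (a - s).
have slope3 s t : s < a -> a < t -> slope s <= (h t - h a) / (t - a).
  move=> sa at_; have st := lt_trans sa at_.
  rewrite /slope ler_pdivrMr ?subr_gt0 // mulrAC ler_pdivlMr ?subr_gt0 //.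
  (* The weight of [s] that makes [a] the barycentre of [s] and [t]. *)
  have l01 : 0 <= (t - a) / (t - s) <= 1.
    rewrite divr_ge0 ?subr_ge0 ?(ltW at_) ?(ltW st) //=.
    by rewrite ler_pdivrMr ?subr_gt0 // mul1r lerD2l lerN2 ltW.
  have ts0 : t - s != 0 by rewrite subr_eq0 gt_eqF.
  have := cvx s t _ l01.
  rewrite (_ : _ * s + _ = a); last by field.
  rewrite -(ler_pM2l (_ : 0 < t - s)) ?subr_gt0 //.
  rewrite (_ : (t - s) * (_ + _) = (t - a) * h s + (a - s) * h t); last by field.
  lra.
have a1 : a - 1 < a by rewrite gtrBl.
have S0 : (slope @` [set s | s < a]) (slope (a - 1)) by exists (a - 1).
have Sub t : a < t -> ubound (slope @` [set s | s < a]) ((h t - h a) / (t - a)).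
  by move=> at_ _ [s sa <-]; exact: slope3.
have aa1 : a < a + 1 by rewrite ltrDl.
exists (sup (slope @` [set s | s < a])) => t.
have [ta|at_|->] := ltgtP t a; last by rewrite subrr mulr0 addr0.
- have : slope t <= sup (slope @` [set s | s < a]).
    by apply: ub_le_sup; [exists ((h (a + 1) - h a) / (a + 1 - a)); exact: Sub|exists t].
  by rewrite {1}/slope ler_pdivrMr ?subr_gt0 //; lra.
- have : sup (slope @` [set s | s < a]) <= (h t - h a) / (t - a).
    by apply: ge_sup; [exists (slope (a - 1))|exact: Sub].
  by rewrite ler_pdivlMr ?subr_gt0 //; lra.
Qed.
(** The chain rule turns sigma^2 f' into sigma times the new derivative; after division by sigma the
    right-hand side is again 1-Lipschitz when h is. *)
Lemma stein_solution_std (R : realType) (mu sigma : R) (h f : R -> R) :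
  0 < sigma -> stein_solution mu sigma h f ->
  std_stein (fun z => (h (mu + sigma * z) - gaussE (fun z => h (mu + sigma * z))) / sigma)
    (fun z => f (mu + sigma * z)).
Proof.
move=> s0 [bf df sf]; split.
  have [M [_ fM]] := bf; exists (M + 1) => x.
  by apply: (fM (M + 1)); rewrite ?ltrDl.
move=> z; set y := mu + sigma * z.
have dfy : is_derive y 1 f (f^`()%classic y).
  by rewrite derive1E; exact: derivableP.
have dy : is_derive z 1 (fun z => mu + sigma * z) sigma.
  by apply: is_derive_eq; rewrite /GRing.scale /=; ring.
apply: is_derive_eq.
have s_neq0 : sigma != 0 by rewrite gt_eqF.
have -> : f^`()%classic y =
    ((y - mu) * f y + (h y - gaussE (fun z => h (mu + sigma * z)))) / sigma ^+ 2.
  by rewrite -sf; field.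
by rewrite /y; field.
Qed.

Lemma stein_solution_exists (R : realType) (mu sigma : R) (h : R -> R) :
  0 < sigma -> (forall a b, `|h a - h b| <= `|a - b|) ->
  exists f, stein_solution mu sigma h f.
Proof.
move=> s0 hl; set m := gaussE (fun z => h (mu + sigma * z)).
have s_neq0 : sigma != 0 by rewrite gt_eqF.
pose k z := (h (mu + sigma * z) - m) / sigma.
have kl a b : `|k a - k b| <= `|a - b|.
  rewrite /k -mulrBl normrM normfV (gtr0_norm s0) ler_pdivrMr //.
  rewrite (_ : h _ - m - _ = h (mu + sigma * a) - h (mu + sigma * b)); last by ring.
  rewrite (le_trans (hl _ _)) // (_ : _ - _ = (a - b) * sigma); last by ring.
  by rewrite normrM (gtr0_norm s0).
have k0 : gaussE k = 0.
  have th : tame (fun z => h (mu + sigma * z)).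
    by apply: tame_comp_affine; exact: lipschitz_tame.
  rewrite (_ : k = fun z => sigma^-1 * h (mu + sigma * z) + - (m / sigma)).
    rewrite gaussED ?gaussEZ ?gaussE_cst -/m; first by ring.
    - by [].
    - exact: tameZ.
    - exact: tame_cst.
  by apply/funext => z; rewrite /k; ring.
have [g [[C gC] dg]] := std_stein_exists kl k0.
pose f x := g ((x - mu) / sigma).
have df (x : R) : is_derive x 1 f (((x - mu) * f x + (h x - m)) / sigma ^+ 2).
  have := dg ((x - mu) / sigma) => ?.
  have dy : is_derive x 1 (fun x => (x - mu) / sigma) sigma^-1.
    by apply: is_derive_eq; rewrite /GRing.scale /=; field.
  rewrite /f; apply: is_derive_eq.
  rewrite /k (_ : mu + sigma * ((x - mu) / sigma) = x); last by field.
  by field.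
exists f; split.
- exists C; split; first exact: num_real.
  by move=> M CM x _; apply: le_trans (gC _) (ltW CM).
- by move=> x; exact: (@ex_derive _ _ _ _ _ _ _ (df x)).
- move=> x; rewrite derive1E (@derive_val _ _ _ _ _ _ _ (df x)).
  by rewrite mulrC divfK ?expf_neq0 // addrAC subrr add0r.
Qed.

(** The bounds hold for every bounded solution, hence for the one that [get] selects. Scaling back
    divides the bound on the derivative by sigma and its Lipschitz constant by sigma^2. *)
Lemma stein_fun_spec (R : realType) (mu sigma : R) (h : R -> R) :
  0 < sigma -> (forall a b, `|h a - h b| <= `|a - b|) ->
  (forall a, exists p, forall t, h a + p * (t - a) <= h t) ->
  exists f' : R -> R, [/\ forall x : R, is_derive x 1 (stein_fun mu sigma h) (f' x),
    exists C : R, forall x, `|stein_fun mu sigma h x| <= C,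
    forall x, sigma ^+ 2 * f' x - (x - mu) * stein_fun mu sigma h x
      = h x - gaussE (fun z => h (mu + sigma * z)),
    forall x, - (Num.sqrt (2 / pi) / sigma) <= f' x <= 0 &
    forall x y, `|f' x - f' y| <= 2 / sigma ^+ 2 * `|x - y|].
Proof.
move=> s0 hl hc; have s_neq0 : sigma != 0 by rewrite gt_eqF.
have solf : stein_solution mu sigma h (stein_fun mu sigma h).
  by apply: (@getPex _ [set f | stein_solution mu sigma h f]); exact: stein_solution_exists.
have := stein_solution_std s0 solf.
move: (stein_fun _ _ _) solf => f [bf df sf].
set m := gaussE _ in sf *; set k := (fun z => (h _ - m) / sigma) => stf.
have kl a b : `|k a - k b| <= `|a - b|.
  rewrite /k -mulrBl normrM normfV (gtr0_norm s0) ler_pdivrMr //.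
  rewrite (_ : h _ - m - _ = h (mu + sigma * a) - h (mu + sigma * b)); last by ring.
  rewrite (le_trans (hl _ _)) // (_ : _ - _ = (a - b) * sigma); last by ring.
  by rewrite normrM (gtr0_norm s0).
have kc a : exists p, forall t, k a + p * (t - a) <= k t.
  have [p hp] := hc (mu + sigma * a); exists p => t.
  rewrite /k -[leLHS](mulfK s_neq0) ler_pM2r ?invr_gt0 //.
  apply: le_trans (_ : h (mu + sigma * a) + p * (mu + sigma * t - (mu + sigma * a)) - m <= _).
    by rewrite le_eqVlt; apply/orP; left; apply/eqP; field.
  by rewrite lerD2r.
have f'E x : x = mu + sigma * ((x - mu) / sigma) by field.
have D x : f^`()%classic x = ((x - mu) / sigma * f x + k ((x - mu) / sigma)) / sigma.
  apply: (mulfI (expf_neq0 2 s_neq0)); rewrite -[LHS](subrK ((x - mu) * f x)) sf.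
  by rewrite /k -f'E; field.
exists f^`()%classic; split => //.
- by move=> x; rewrite derive1E; exact: derivableP.
- have [M [_ fM]] := bf; exists (M + 1) => x.
  by apply: (fM (M + 1)); rewrite ?ltrDl.
- move=> x; rewrite D; apply/andP; split.
    rewrite -mulNr ler_pM2r ?invr_gt0 //.
    by have := std_stein_derive_ge ((x - mu) / sigma) kl stf; rewrite /= -f'E.
  rewrite pmulr_lle0 ?invr_gt0 //.
  by have := std_stein_derive_le0 ((x - mu) / sigma) kc stf; rewrite /= -f'E.
- move=> x y; rewrite !D -mulrBl normrM normfV (gtr0_norm s0) ler_pdivrMr //.
  have := std_stein_derive_lipschitz ((x - mu) / sigma) ((y - mu) / sigma) kl stf.
  rewrite /= -!f'E => /le_trans; apply.
  rewrite -mulrBl (_ : x - mu - (y - mu) = x - y); last by ring.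
  rewrite normrM normfV (gtr0_norm s0) le_eqVlt; apply/orP; left; apply/eqP; field.
  exact: s_neq0.
Qed.

(** * The error of a single round *)

Lemma derive_lipschitz_expansion (R : realType) (f f' : R -> R) (L u g : R) :
  (forall x : R, is_derive x 1 f (f' x)) ->
  (forall x y, `|f' x - f' y| <= L * `|x - y|) ->
  g ^+ 2 * f' u - L / 2 * `|g| ^+ 3 <= g * (f (u + g) - f u).
Proof.
move=> df fl.
(* The claim is phi 0 <= phi 1. The quadratic term contributes t L |g|^3 to the derivative, which
   offsets the Lipschitz bound on g^2 (f'(u + t g) - f'(u)). *)
pose phi t := g * f (u + t * g) - t * (g ^+ 2 * f' u) + t ^+ 2 * (L / 2 * `|g| ^+ 3).
pose phi' t := g ^+ 2 * (f' (u + t * g) - f' u) + t * (L * `|g| ^+ 3).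
have dphi (t : R) : is_derive t 1 phi (phi' t).
  have := df (u + t * g) => ?.
  have dy : is_derive t 1 (fun t => u + t * g) g.
    by apply: is_derive_eq; rewrite /GRing.scale /=; ring.
  have d1 : is_derive t 1 (fun t => f (u + t * g)) (g * f' (u + t * g)).
    by apply: is_derive_eq; ring.
  by rewrite /phi; apply: is_derive_eq; rewrite /phi' /GRing.scale /=; field.
have phi'0 t : 0 <= t <= 1 -> 0 <= phi' t.
  move=> /andP[t0 _]; rewrite /phi'.
  have := fl (u + t * g) u; rewrite addrAC subrr add0r normrM (ger0_norm t0).
  rewrite ler_norml => /andP[/(ler_wpM2l (sqr_ge0 g)) + _].
  rewrite -(real_normK (num_real g)) exprS; lra.
have := @le_derive_ge0 _ 0 1 phi phi' ler01 (fun t _ => dphi t) phi'0.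
rewrite /phi mul1r mul0r addr0 expr1n expr0n /= !mul0r mul1r subr0 addr0 mul1r; lra.
Qed.

(** Replacing f'(u + g) by f'(u) costs c L |g|, and expanding f at u costs L |g|^3 / 2. What remains
    is (c - g^2) f'(u), which is nonpositive if g^2 <= c and at most B (g^2 - c) otherwise. *)
Lemma stein_pointwise (R : realType) (f f' : R -> R) (B L c u g : R) :
  (forall x : R, is_derive x 1 f (f' x)) ->
  (forall x y, `|f' x - f' y| <= L * `|x - y|) ->
  (forall x, - B <= f' x <= 0) -> 0 <= c ->
  c * f' (u + g) - g * (f (u + g) - f u) <=
    B * Num.max (g ^+ 2 - c) 0 + (c * L * `|g| + L / 2 * `|g| ^+ 3).
Proof.
move=> df fl fB c0.
have h1 := derive_lipschitz_expansion u g df fl.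
have h2 : c * f' (u + g) <= c * (f' u + L * `|g|).
  rewrite ler_wpM2l // -lerBlDl; apply: le_trans (ler_norm _) _.
  by apply: le_trans (fl _ _) _; rewrite addrAC subrr add0r.
have /andP[fu_ge fu_le] := fB u.
have h3 : (c - g ^+ 2) * f' u <= B * Num.max (g ^+ 2 - c) 0.
  have [gc|gc] := leP (g ^+ 2 - c) 0.
    by rewrite mulr0 mulr_ge0_le0 // -opprB oppr_ge0.
  by rewrite -opprB mulNr -mulrN mulrC ler_pM2r // lerNl.
lra.
Qed.

Lemma stein_round (R : realType) (h : R -> R) (s sigma rho g : R) :
  0 < sigma -> 0 <= rho <= sigma ->
  (forall a b, `|h a - h b| <= `|a - b|) ->
  (forall a, exists p, forall t, h a + p * (t - a) <= h t) ->
  g * gaussE (fun z => stein_fun s sigma h (s + rho * z)) <=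
    gaussE (fun z => h (s + sigma * z)) - gaussE (fun z => h (s + g + rho * z)) +
    (Num.sqrt (2 / pi) *
       (Num.max (g ^+ 2 - (sigma ^+ 2 - rho ^+ 2)) 0 / sigma)
     + (2 * (sigma ^+ 2 - rho ^+ 2) * `|g| + `|g| ^+ 3) / sigma ^+ 2).
Proof.
move=> s0 /andP[r0 rs] hl hc; set c := _ - rho ^+ 2.
have c0 : 0 <= c by rewrite subr_ge0 ler_sqr // nnegrE ltW.
have s_neq0 : sigma != 0 by rewrite gt_eqF.
have [f' [df [C fC] sf f'B f'L]] := stein_fun_spec s s0 hl hc.
move: (stein_fun s sigma h) df fC sf => f df fC sf.
set m := gaussE (fun z => h (s + sigma * z)) in sf *.
set err := (X in _ <= _ + X).
pose y z := s + g + rho * z.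
have cf := is_derive_continuous df.
have cf' : continuous f'.
  have L0 : 0 < 2 / sigma ^+ 2 by rewrite divr_gt0 // exprn_gt0.
  move=> x; apply/cvgrPdist_le => e e0; near=> t.
  apply: le_trans (f'L _ _) _; rewrite mulrC -ler_pdivlMr //.
  by near: t; apply: cvgr_dist_le; rewrite // divr_gt0.
have f'b x : `|f' x| <= Num.sqrt (2 / pi) / sigma.
  have /andP[lo hi] := f'B x; rewrite ler_norml lo /=; apply: le_trans hi _.
  by rewrite divr_ge0 ?sqrtr_ge0 ?(ltW s0).
have tf := tame_bounded cf fC; have tf' := tame_bounded cf' f'b.
have th := lipschitz_tame hl.
have cfy : continuous (fun z => f (y z)) := (tame_comp_affine (s + g) rho tf).1.
have cfy' : continuous (fun z => rho * f' (y z)) :=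
  (tameZ rho (tame_comp_affine (s + g) rho tf')).1.
(* Integration by parts for z -> f(y z), the factor [rho] coming from the chain rule; for rho = 0,
   possible in the last round, both sides are 0. *)
have stein : gaussE (fun z => z * f (y z)) = gaussE (fun z => rho * f' (y z)).
  apply: (@gaussE_derive _ C (rho * (Num.sqrt (2 / pi) / sigma))) => //.
    move=> x; have := df (y x) => ?.
    have dy : is_derive x 1 y rho.
      by apply: is_derive_eq; rewrite /GRing.scale /=; ring.
    by apply: is_derive_eq; ring.
  by move=> x; rewrite normrM (ger0_norm r0) ler_wpM2l.
have t1 : tame (fun z => h (y z)) := tame_comp_affine (s + g) rho th.
have t2 : tame (fun z => rho * (z * f (y z))) := tameZ _ (tame_idM cfy (fun z => fC (y z))).
have t3 : tame (fun z => - rho * (rho * f' (y z))).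
  by apply: tameZ; apply: tameZ; exact: tame_comp_affine.
have t4 : tame (fun z => g * f (s + rho * z)) by apply: tameZ; exact: tame_comp_affine.
have t12 := tameD t1 t2; have t123 := tameD t12 t3; have t1234 := tameD t123 t4.
(* The two middle terms cancel in expectation by [stein]. With them, the Stein equation at y z and y
   z - s = g + rho z reduce the integrand to m plus the left-hand side of [stein_pointwise]. *)
have : gaussE (fun z => h (y z) + rho * (z * f (y z))
      + - rho * (rho * f' (y z)) + g * f (s + rho * z))
    <= gaussE (fun _ => m + err).
  apply: le_gaussE => // [|z]; first exact: tame_cst.
  have P := @stein_pointwise _ f f' _ _ c (s + rho * z) g df f'L f'B c0.
  have e1 : s + rho * z + g = y z by rewrite /y; ring.
  rewrite e1 in P.
  have S := sf (y z).
  have -> : h (y z) = m + (sigma ^+ 2 * f' (y z) - (y z - s) * f (y z)) by rewrite S; ring.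
  rewrite -!addrA lerD2l.
  apply: le_trans (_ : _ <= c * f' (y z) - g * (f (y z) - f (s + rho * z))) _.
    by rewrite le_eqVlt; apply/orP; left; apply/eqP; rewrite /c /y; ring.
  apply: le_trans P _; rewrite le_eqVlt; apply/orP; left; apply/eqP; rewrite /err; field.
  exact: s_neq0.
rewrite gaussE_cst (gaussED t123 t4) (gaussED t12 t3) (gaussED t1 t2).
rewrite (gaussEZ rho (tame_idM cfy (fun z => fC (y z)))) stein.
rewrite (gaussEZ (- rho) (tameZ rho (tame_comp_affine (s + g) rho tf'))).
by rewrite (gaussEZ g (tame_comp_affine s rho tf)) /y; lra.
Unshelve. all: by end_near. Qed.

(** * The transcript of the game and the sum over the rounds *)

Lemma size_gradients (R : Type) (alg : algorithm R) (adv : adversary R) (t : nat) :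
  size (gradients alg adv t) = t.
Proof.
rewrite /gradients; elim: t => //= t.
by case: (play alg adv t) => xs gs /= sz; rewrite size_rcons sz.
Qed.

Lemma size_play1 (R : Type) (alg : algorithm R) (adv : adversary R) (t : nat) :
  size (play alg adv t).1 = t.
Proof.
elim: t => //= t.
by case: (play alg adv t) => xs gs /= sz; rewrite size_rcons sz.
Qed.

Lemma decisionS (R : realType) (alg : algorithm R) (adv : adversary R) (t : nat) :
  decision alg adv t.+1 = alg (gradients alg adv t).
Proof.
have := size_play1 alg adv t; rewrite /decision /gradients /=.
by case: (play alg adv t) => xs gs /= sz; rewrite nth_rcons sz ltnn eqxx.
Qed.

Lemma gradientsS (R : realType) (alg : algorithm R) (adv : adversary R) (t : nat) :
  gradients alg adv t.+1 = rcons (gradients alg adv t) (gradient alg adv t.+1).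
Proof.
have := size_gradients alg adv t; rewrite /gradient /gradients /=.
by case: (play alg adv t) => xs gs /= sz; rewrite nth_rcons sz ltnn eqxx.
Qed.

(** Identifies the parameters that the algorithm computes during play with those read off the
    complete transcript. *)
Lemma take_gradients (R : realType) (alg : algorithm R) (adv : adversary R) (t T : nat) :
  (t <= T)%N -> take t (gradients alg adv T) = gradients alg adv t.
Proof.
move=> tT; rewrite -(subnKC tT); elim: (T - t)%N => [|n IHn].
  by rewrite addn0 -[X in take X](size_gradients alg adv t) take_size.
by rewrite addnS gradientsS -cats1 takel_cat ?size_gradients ?leq_addr.
Qed.

Lemma sum_gradients (R : realType) (alg : algorithm R) (adv : adversary R) (t : nat) :
  \sum_(g <- gradients alg adv t) g = \sum_(0 <= i < t) gradient alg adv i.+1.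
Proof.
elim: t => [|t IHt]; first by rewrite big_nil big_geq.
by rewrite gradientsS big_rcons /= IHt big_nat_recr.
Qed.

Theorem theorem3 (R : realType) (T : nat) (h : R -> R) (rho : policy R)
    (adv : adversary R) :
  (1 <= T)%N ->
  convex_function [set: R^o] h ->
  1.-lipschitz h ->
  admissible T rho ->
  let alg := stein_algorithm h rho in
  let x t := decision alg adv t in
  let g t := gradient alg adv t in
  let r t := param rho (gradients alg adv T) t in
  let c t := r t.-1 ^+ 2 - r t ^+ 2 in
  \sum_(1 <= t < T.+1) g t * x t <=
    - gaussE (fun z => h (\sum_(1 <= t < T.+1) g t + r T * z))
    + gaussE (fun z => h (r 0%N * z))
    + \sum_(1 <= t < T.+1)
        (Num.sqrt (2 / pi) * (Num.max (g t ^+ 2 - c t) 0 / r t.-1)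
         + (2 * c t * `|g t| + `|g t| ^+ 3) / r t.-1 ^+ 2).
Proof.
move=> _ ch lh [rho0 rho_adm]; cbv zeta.
set alg := stein_algorithm h rho.
set r := param rho (gradients alg adv T).
have hl a b : `|h a - h b| <= `|a - b|.
  by have := lh (a, b) (conj I I); rewrite /= mul1r.
have hc a := convex_subgradient a ch.
have r_ge t : (t < T)%N -> 0 <= r t.+1 <= r t.
  move=> tT; have [] := rho_adm (gradients alg adv T) t.+1 tT;
    by rewrite ?size_gradients ?ltnS ?(ltnW tT).
have r_gt0 t : (t < T)%N -> 0 < r t.
  case: t => [_|t tT].
    by move: rho0; rewrite /r /param /= take0.
  have [|_] := rho_adm (gradients alg adv T) t.+1 (ltnW tT); last exact.
  by rewrite size_gradients ltnS; exact: ltnW (ltnW _).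
rewrite !big_add1 /=.
pose g t := gradient alg adv t.+1; pose c t := r t ^+ 2 - r t.+1 ^+ 2.
(* The induction is on the number n of rounds summed, with T fixed: [r] keeps referring to the
   transcript of all T rounds. Indices are shifted, so that index t stands for round t + 1. *)
suff ind n : (n <= T)%N ->
  \sum_(0 <= t < n) g t * decision alg adv t.+1 <=
    - gaussE (fun z => h (\sum_(0 <= t < n) g t + r n * z))
    + gaussE (fun z => h (r 0%N * z))
    + \sum_(0 <= t < n)
        (Num.sqrt (2 / pi) * (Num.max (g t ^+ 2 - c t) 0 / r t)
         + (2 * c t * `|g t| + `|g t| ^+ 3) / r t ^+ 2).
  exact: ind.
elim: n => [_|n IHn nT].
  rewrite !big_geq // addr0 (_ : (fun z => h (0 + _ * z)) = fun z => h (r 0%N * z)).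
    by rewrite addNr.
  by apply/funext => z; rewrite add0r.
rewrite !big_nat_recr //=.
(* In round n + 1 the algorithm sees n gradients; r n and r (n + 1) look at no more than these, so
   truncating the full transcript changes neither. *)
have -> : decision alg adv n.+1 =
    gaussE (fun z => stein_fun (\sum_(0 <= t < n) g t) (r n) h
      (\sum_(0 <= t < n) g t + r n.+1 * z)).
  rewrite decisionS /alg /stein_algorithm -/alg size_gradients sum_gradients /=.
  by rewrite /r /param /= -(take_gradients alg adv (ltnW nT)) !take_takel ?leq_pred.
have := stein_round (\sum_(0 <= t < n) g t) (g n) (r_gt0 _ nT) (r_ge _ nT) hl hc.
have := IHn (ltnW nT).
rewrite /c; lra.
Qed.
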